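(* Let $\Omega$ be a finite set, let $I\subseteq\mathbb{R}$ be an open interval, and let $\gamma\colon I\to\mathbb{R}^\Omega$, $t\mapsto\gamma(t)$, be a differentiable curve with $\gamma(t)\in\Delta(\Omega)$ for all $t\in I$. Then the (ordinary) velocity $t\mapsto\dot\gamma(t)$ is a curve in the space of contrasts $C(\Omega)$. Moreover, for each $t\in I$ there exists $s(t)\in\mathbb{R}^\Omega$ such that $$\dot\gamma(x;t)=s(x;t)\,\gamma(x;t)\ \text{ for all } x\in\Omega,\qquad\text{and}\qquad \operatorname{supp}\dot\gamma(t)=\operatorname{supp}s(t)\cap\operatorname{supp}\gamma(t).$$
   Context: $\mathbb{R}^\Omega$ is the space of real-valued functions on the finite set $\Omega$. The closed probability simplex is $\Delta(\Omega)=\{p\in\mathbb{R}^\Omega : p(x)\ge 0\ \forall x,\ \sum_{x\in\Omega}p(x)=1\}$. The space of contrasts is $C(\Omega)=\{v\in\mathbb{R}^\Omega : \sum_{x\in\Omega}v(x)=0\}$. For $v\in\mathbb{R}^\Omega$, $\operatorname{supp}v=\{x\in\Omega : v(x)\ne 0\}$. For a curve $\gamma$, $\gamma(x;t)$ denotes the component of $\gamma(t)$ at $x\in\Omega$, and $\dot\gamma$ denotes the derivative with respect to $t$; similarly $s(x;t)$ is the component of $s(t)$ at $x$. *)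

(* Defs.v *)
From HB Require Import structures.
From mathcomp Require Import all_boot all_order all_algebra.
From mathcomp Require Import all_classical all_reals all_analysis.

Set Implicit Arguments.
Unset Strict Implicit.
Unset Printing Implicit Defensive.

Import Order.TTheory GRing.Theory Num.Theory.
Import numFieldNormedType.Exports.

Local Open Scope ring_scope.
Local Open Scope classical_set_scope.

(* R^Omega is rendered as {ffun Omega -> R^o}: the codomain R^o, rather than R,
   is what makes it an R-module. It is given the sup norm (the convention of
   mathcomp-analysis for matrices), whose topology is the usual one; this makes
   it a normedModType, so that derivable and derive1 apply to curves in it. *)
Section SupNorm.
Context {R : realType} {Omega : finType}.
Implicit Types v w : {ffun Omega -> R^o}.

Definition sup_norm v : R := \big[Num.max/0]_(x : Omega) `|v x|.

Lemma le_sup_norm v x : `|v x| <= sup_norm v.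
Proof. exact: le_bigmax. Qed.

Lemma sup_norm_le v (c : R) :
  0 <= c -> (forall x, `|v x| <= c) -> sup_norm v <= c.
Proof. by move=> c0 vc; apply: bigmax_le. Qed.

Lemma sup_norm_ge0 v : 0 <= sup_norm v.
Proof. exact: bigmax_ge_id. Qed.

Lemma sup_normD v w : sup_norm (v + w) <= sup_norm v + sup_norm w.
Proof.
apply: sup_norm_le => [|x]; first by rewrite addr_ge0 ?sup_norm_ge0.
by rewrite ffunE (le_trans (ler_normD _ _))// lerD ?le_sup_norm.
Qed.

Lemma sup_normZ (l : R) v : sup_norm (l *: v) = `|l| * sup_norm v.
Proof.
have le_normZ (k : R) w : sup_norm (k *: w) <= `|k| * sup_norm w.
  apply: sup_norm_le => [|x]; first by rewrite mulr_ge0 ?sup_norm_ge0.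
  by rewrite ffunE normrM ler_wpM2l ?le_sup_norm.
apply/eqP; rewrite eq_le le_normZ /=.
have [->|l0] := eqVneq l 0; first by rewrite normr0 mul0r sup_norm_ge0.
rewrite -ler_pdivlMl ?normr_gt0// -normfV.
by rewrite -[v in leLHS](scalerK l0) le_normZ.
Qed.

Lemma sup_norm_eq0 v : sup_norm v = 0 -> v = 0.
Proof.
move=> v0; apply/ffunP => x; rewrite ffunE; apply/eqP.
by rewrite -normr_le0 -v0 le_sup_norm.
Qed.

HB.instance Definition _ := Lmodule_isNormed.Build R {ffun Omega -> R^o}
  sup_normD sup_normZ sup_norm_eq0.

End SupNorm.

Definition simplex (R : realType) (Omega : finType) :
    set {ffun Omega -> R^o} :=
  [set p | (forall x, 0 <= p x) /\ \sum_(x : Omega) p x = 1].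

Definition contrasts (R : realType) (Omega : finType) :
    set {ffun Omega -> R^o} :=
  [set v | \sum_(x : Omega) v x = 0].

Definition supp (R : realType) (Omega : finType)
    (v : {ffun Omega -> R^o}) : {set Omega} :=
  [set x | v x != 0]%SET.

(* Main.v *)
(* At an interior time t where a linear functional L is minimal along gamma, L
   vanishes on the velocity (Fermat). On the simplex this applies to the total
   mass, which is constant, and to the coordinate at x whenever gamma(x;t) = 0,
   since coordinates are nonnegative. Hence s = gamma' / gamma works, the value 0
   given by division by 0 being harmless: gamma' vanishes there too. *)
Require Import Defs.
From HB Require Import structures.
From mathcomp Require Import all_boot all_order all_algebra.
From mathcomp Require Import all_classical all_reals all_analysis.

Import Order.TTheory GRing.Theory Num.Theory.
Import numFieldNormedType.Exports.

Local Open Scope ring_scope.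
Local Open Scope classical_set_scope.

Section ContinuousLinear.
Context {R : realType} {V W : normedModType R}.

Lemma linear_bound_continuous (L : {linear V -> W}) (k : R) :
  0 <= k -> (forall v, `|L v| <= k * `|v|) -> continuous L.
Proof.
move=> k0 Lk; apply/linear_bounded_continuous/bounded_funP => r.
by exists (k * r) => v vr; rewrite (le_trans (Lk v))// ler_wpM2l.
Qed.

(** Chain rule: a continuous linear map is its own differential at every point. *)
Lemma is_derive1_linear (L : {linear V -> W}) (f : R -> V) (t : R) :
  continuous L -> derivable f t 1 -> is_derive t 1 (L \o f) (L (f^`() t)).
Proof.
move=> Lc /derivable1_diffP fd.
have Ld : differentiable L (f t) by exact: linear_differentiable.
have Lfd : differentiable (L \o f) t by exact: differentiable_comp.
apply: DeriveDef; first exact/derivable1_diffP.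
by rewrite deriveE// diff_comp//= diff_lin// derive1E'.
Qed.

End ContinuousLinear.

Lemma derive1_open_min (R : realType) (I : set R) (f : R -> R) (t df : R) :
  open I -> I t -> (forall u, I u -> derivable f u 1) ->
  (forall u, I u -> f t <= f u) -> is_derive t 1 f df -> df = 0.
Proof.
move=> Io It fI tmin [_ <-].
(* Fermat's theorem [derive1_at_min] is stated on an interval with endpoints; a ball around [t]
   inside [I] provides one. *)
have /nbhs_ballP[e /= e0 teI] : nbhs t I by exact: open_nbhs_nbhs.
have subI u : u \in `]t - e, t + e[%R -> I u.
  by move=> ?; apply: teI; rewrite ball_itv.
have tin : t \in `]t - e, t + e[%R by rewrite in_itv/= ltrBlDr ltrDl e0.
have te : t - e <= t + e by rewrite lerD2l (le_trans _ (ltW e0))// oppr_le0 ltW.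
by have [] : is_derive t 1 f 0
  by apply: derive1_at_min te _ tin _ => u /subI; [exact: fI|exact: tmin].
Qed.

Section Coordinates.
Context {R : realType} {Omega : finType}.
Implicit Types v : {ffun Omega -> R^o}.

(** Naming the coordinate functional lets it carry a linear structure, as [linear_min_velocity]
    requires. *)
Definition eval_at (x : Omega) v : R^o := v x.

Fact eval_at_linear x : linear (eval_at x).
Proof. by move=> a u v; rewrite /eval_at !ffunE. Qed.

HB.instance Definition _ x :=
  GRing.isLinear.Build R {ffun Omega -> R^o} R^o _ (eval_at x) (eval_at_linear x).

Lemma eval_at_continuous x : continuous (eval_at x).
Proof.
apply: (@linear_bound_continuous _ _ _ (eval_at x) 1) => // v.
by rewrite mul1r; exact: le_sup_norm.
Qed.

Definition mass v : R^o := \sum_x v x.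

Fact mass_linear : linear mass.
Proof.
move=> a u v; rewrite /mass scaler_sumr -big_split/=.
by apply: eq_bigr => x _; rewrite !ffunE.
Qed.

HB.instance Definition _ :=
  GRing.isLinear.Build R {ffun Omega -> R^o} R^o _ mass mass_linear.

Lemma mass_continuous : continuous mass.
Proof.
(* The constant counts the summands, each at most the sup norm in absolute value. *)
apply: (@linear_bound_continuous _ _ _ mass #|Omega|%:R) => // v.
rewrite mulr_natl -sumr_const (le_trans (ler_norm_sum _ _ _))//.
by apply: ler_sum => x _; exact: le_sup_norm.
Qed.

Lemma linear_min_velocity (L : {linear {ffun Omega -> R^o} -> R^o})
    (I : set R) (gamma : R -> {ffun Omega -> R^o}) (t : R) :
  continuous L -> open I -> I t -> (forall u, I u -> derivable gamma u 1) ->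
  (forall u, I u -> (L (gamma t) : R) <= L (gamma u)) ->
  L (gamma^`() t) = 0.
Proof.
move=> Lc Io It gd tmin.
have Lg u (Iu : I u) := is_derive1_linear L gamma u Lc (gd u Iu).
apply: (derive1_open_min _ I (L \o gamma) t _ Io It _ tmin (Lg t It)).
by move=> u /Lg[].
Qed.

End Coordinates.

Theorem theorem3p1 (R : realType) (Omega : finType) (I : set R)
  (gamma : R -> {ffun Omega -> R^o})
  (I_interval : is_interval I) (I_open : open I)
  (gamma_derivable : forall t, I t -> derivable gamma t 1)
  (gamma_simplex : forall t, I t -> simplex (gamma t)) :
  (forall t, I t -> contrasts (gamma^`() t)) /\
  (forall t, I t -> exists s : {ffun Omega -> R^o},
     (forall x, gamma^`() t x = s x * gamma t x) /\
     supp (gamma^`() t) = supp s :&: supp (gamma t)).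
Proof.
split=> t It.
  apply: (linear_min_velocity mass I gamma t) => // [|u Iu].
    exact: mass_continuous.
  have [[_ mt] [_ mu]] := (gamma_simplex t It, gamma_simplex u Iu).
  by rewrite [leLHS]mt [leRHS]mu.
(* The velocity is tangent to the face of the simplex that has [gamma t] in its relative
   interior. *)
have face x : gamma t x = 0 -> gamma^`() t x = 0.
  move=> gtx; apply: (linear_min_velocity (eval_at x) I gamma t) => // [|u Iu].
    exact: eval_at_continuous.
  by rewrite [leLHS]gtx; have [g0 _] := gamma_simplex u Iu; exact: g0.
(* On the support of [gamma t], this is the logarithmic derivative of [gamma]. *)
pose s : {ffun Omega -> R^o} := [ffun x => gamma^`()%classic t x / gamma t x].
have sE x : gamma^`() t x = s x * gamma t x.
  rewrite ffunE; have [g0|g0] := eqVneq (gamma t x) 0; last by rewrite divfK.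
  by rewrite (face x g0) mul0r mul0r.
exists s; split=> //.
(* The support identity follows from [sE] alone: in a field, a product is nonzero exactly when both
   factors are. *)
by apply/setP => x; rewrite !inE sE mulf_eq0 negb_or.
Qed.
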